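(* If $K$ and $L$ are compact lines and the Banach spaces $C(K)$ and $C(L)$ are isomorphic, then $\chi(K)=\chi(L)$.
   Context: A compact line is a linearly ordered set that is compact in its order topology. $C(K)$ is the Banach space of real-valued continuous functions on $K$ with the supremum norm; isomorphic means linearly homeomorphic. The character $\chi(F)$ of a topological space $F$ is the supremum over points $x\in F$ of the least cardinality of a base at $x$. *)

(* Defs.v *)
From HB Require Import structures.
From mathcomp Require Import all_boot all_order all_algebra.
From mathcomp Require Import all_classical all_reals.
From mathcomp Require Import topology normedtype.
From mathcomp Require Import ring lra.

Set Implicit Arguments.
Unset Strict Implicit.
Unset Printing Implicit Defensive.

Import Order.TTheory GRing.Theory Num.Theory.
Import numFieldNormedType.Exports.

Local Open Scope classical_set_scope.
Local Open Scope card_scope.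
Local Open Scope ring_scope.

(* Any nonempty family of sets has a member of least cardinality. Take a
   maximal set S of choice functions that pairwise differ at every index: some
   projection of S must be onto, and S embeds into every member. *)
Lemma card_least (I : Type) (T : I -> Type) (A : forall i, set (T i)) (i0 : I) :
  exists i, forall j, A i #<= A j.
Proof.
pose P (S : set (forall i, T i)) :=
  (forall s, S s -> forall i, A i (s i)) /\
  (forall s t, S s -> S t -> forall i, s i = t i -> s = t).
have [|S [[SA Sinj] Smax]] := @Zorn_bigcup _ P.
  move=> F FP Ftot; split=> [s [B FB Bs]|s t [B FB Bs] [C FC Ct] i st].
    exact: (FP _ FB).1 _ Bs.
  have [BC|CB] := Ftot _ _ FB FC.
    by apply: (FP _ FC).2 st => //; exact: BC.
  by apply: (FP _ FB).2 st => //; exact: CB.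
have [i iS] : exists i, forall x, A i x -> exists2 s, S s & s i = x.
  apply: contrapT => /forallNP noi.
  have pick i : {x | A i x /\ forall s, S s -> s i <> x}.
    apply: cid; have /existsNP[x /not_implyP[Ax nx]] := noi i.
    by exists x; split=> // s Ss sx; apply: nx; exists s.
  pose t i := projT1 (pick i).
  have tA i : A i (t i) by exact: (projT2 (pick i)).1.
  have tS i s : S s -> s i <> t i by exact: (projT2 (pick i)).2.
  have St : (S `|` [set t]) t by right.
  have nSt : ~ S t by move=> /(tS i0); exact.
  apply: (Smax (S `|` [set t])).
    by split=> [s|]; [left|move=> /(_ _ St)].
  split=> [s [/SA//|->//]|s s' [Ss|->] [Ss'|->] j] //.
  - exact: Sinj.
  - by move/(tS j s Ss).
  - by move/esym/(tS j s' Ss').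
exists i => j.
have sel (x : A i) : {s | S s /\ s i = val x}.
  by apply: cid; have [s ? ?] := iS _ (set_valP x); exists s.
pose f (x : A i) : A j :=
  SigSub (mem_set (SA _ (projT2 (sel x)).1 j)).
apply/card_leP/injfunPex; exists f => // x y _ _ /(congr1 val) /=.
rewrite /f; case: (sel x) => s [Ss sx]; case: (sel y) => t [St ty] /= st.
by apply: val_inj; rewrite -sx -ty (Sinj _ _ Ss St _ st).
Qed.

Lemma card_le_total (T U : Type) (A : set T) (B : set U) :
  A #<= B \/ B #<= A.
Proof.
pose TT (b : bool) : Type := if b then T else U.
pose AA (b : bool) : set (TT b) :=
  if b as b return set (TT b) then A else B.
by have [[] h] := @card_least bool TT AA true; [left; exact: (h false)
  |right; exact: (h true)].
Qed.

(* Cardinals are represented by sets, up to equipotence [#=]. This is the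
   supremum of the cardinals of the [F i]: all of them are at most that of [U],
   so it is represented by a subset of [U], and by [card_sup_spec] it is below
   every upper bound, of whatever type. *)
Definition card_sup (I U : Type) (F : I -> set U) : set U :=
  xget set0 [set A : set U | (forall i, F i #<= A) /\
    forall A' : set U, (forall i, F i #<= A') -> A #<= A'].

Lemma card_sup_spec (I U : Type) (F : I -> set U) :
  (forall i, F i #<= card_sup F) /\
  forall (V : Type) (A : set V), (forall i, F i #<= A) -> card_sup F #<= A.
Proof.
pose ub := {A : set U | forall i, F i #<= A}.
have ubT : ub by exists setT => i; exact: card_leT.
have [[A Aub] /= Amin] := @card_least ub (fun=> U) (fun A => sval A) ubT.
have [] : (forall i, F i #<= card_sup F) /\
    forall A' : set U, (forall i, F i #<= A') -> card_sup F #<= A'.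
  rewrite /card_sup; case: xgetP => [B -> //|/(_ A)]; case.
  by split=> // A' A'ub; exact: (Amin (exist _ A' A'ub)).
move=> supub supmin; split=> // V B Bub.
have [//|Bsup] := card_le_total (card_sup F) B.
have /card_leP[f] := Bsup.
pose B' : set U := [set val (f x) | x in [set: B]].
have BB' : B #<= B'.
  apply/card_leP/injfunPex.
  have fB' x : val (f x) \in B' by apply/mem_set; exists x.
  exists (fun x => SigSub (fB' x)) => // x y _ _ /(congr1 val) /= /val_inj.
  by apply: inj; exact: in_setT.
apply: (@card_le_trans _ _ _ B').
  by apply: supmin => i; exact: card_le_trans (Bub i) BB'.
by apply: card_le_trans (card_image_le _ _) _; rewrite (card_le_eql (card_setT _)).
Qed.

Definition local_base (T : topologicalType) (x : T) (B : set (set T)) :=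
  B `<=` open_nbhs x /\ filter_from B id --> x.

Definition min_local_base (T : topologicalType) (x : T) : set (set T) :=
  xget set0 [set B | local_base x B /\
    forall B', local_base x B' -> B #<= B'].

Lemma min_local_baseP (T : topologicalType) (x : T) :
  local_base x (min_local_base x) /\
  forall B, local_base x B -> min_local_base x #<= B.
Proof.
have xB : local_base x (open_nbhs x).
  by split=> // A; rewrite nbhsE.
have [[B xB0] /= Bmin] := @card_least {B | local_base x B} (fun=> set T)
  (fun B => sval B) (exist _ _ xB).
rewrite /min_local_base; case: xgetP => [C -> //|/(_ B)]; case.
by split=> // B' xB'; exact: (Bmin (exist _ B' xB')).
Qed.

(* The supremum over [x] of the least cardinality of a base at [x]; see
   [min_local_baseP] and [card_sup_spec]. *)
Definition character (T : topologicalType) : set (set T) :=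
  card_sup (@min_local_base T).
Arguments character T : clear implicits.

HB.mixin Record isCompactSpace T & Topological T := {
  compact_space : compact [set: T]
}.

#[short(type="compactTopologicalType")]
HB.structure Definition CompactTopological :=
  { T of Topological T & isCompactSpace T }.

#[short(type="compactLineType")]
HB.structure Definition CompactLine d :=
  { T of OrderTopological d T & isCompactSpace T }.

Definition continuous_fun (R : realType) (K : compactTopologicalType) : Type :=
  continuousType K R.

Section continuous_fun.
Context {R : realType} {K : compactTopologicalType}.

Local Notation CK := (continuous_fun R K).

HB.instance Definition _ := Choice.on CK.

Definition eval_cf (f : CK) : K -> R := f : continuousType K R.
Coercion eval_cf : continuous_fun >-> Funclass.

Lemma cf_continuous (f : CK) : continuous f.
Proof. exact: cts_fun. Qed.

Lemma cfP (f g : CK) : f =1 g -> f = g.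
Proof. by move=> fg; exact/continuousEP. Qed.

Definition mkcf (f : K -> R) (fc : continuous f) : CK :=
  mkcts fc : continuousType K R.

Let cst_cf (a : R) : continuous (fun _ : K => a).
Proof. by move=> x; exact: cvg_cst. Qed.
Let opp_cf (f : CK) : continuous (fun x => - f x).
Proof. by move=> x; exact: cvgN (@cf_continuous f x). Qed.
Let add_cf (f g : CK) : continuous (fun x => f x + g x).
Proof. by move=> x; exact: cvgD (@cf_continuous f x) (@cf_continuous g x). Qed.
Let scale_cf (a : R) (f : CK) : continuous (fun x => a * f x).
Proof. by move=> x; exact: cvgMl_tmp (@cf_continuous f x). Qed.

Definition cf0 : CK := mkcf (@cst_cf 0).
Definition cfN (f : CK) : CK := mkcf (@opp_cf f).
Definition cfD (f g : CK) : CK := mkcf (@add_cf f g).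
Definition cfZ (a : R) (f : CK) : CK := mkcf (@scale_cf a f).

Let cfDA : associative cfD.
Proof. by move=> f g h; apply: cfP => x /=; exact: addrA. Qed.
Let cfDC : commutative cfD.
Proof. by move=> f g; apply: cfP => x /=; exact: addrC. Qed.
Let cf0D : left_id cf0 cfD.
Proof. by move=> f; apply: cfP => x /=; exact: add0r. Qed.
Let cfND : left_inverse cf0 cfN cfD.
Proof. by move=> f; apply: cfP => x /=; exact: addNr. Qed.

HB.instance Definition _ := GRing.isZmodule.Build CK cfDA cfDC cf0D cfND.

Let cfZA (a b : R) (f : CK) : cfZ a (cfZ b f) = cfZ (a * b) f.
Proof. by apply: cfP => x /=; exact: mulrA. Qed.
Let cf1Z : left_id 1 cfZ.
Proof. by move=> f; apply: cfP => x /=; exact: mul1r. Qed.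
Let cfZDr : right_distributive cfZ +%R.
Proof. by move=> a f g; apply: cfP => x /=; exact: mulrDr. Qed.
Let cfZDl (f : CK) : {morph cfZ^~ f : a b / a + b}.
Proof. by move=> a b; apply: cfP => x /=; exact: mulrDl. Qed.

HB.instance Definition _ :=
  GRing.Zmodule_isLmodule.Build R CK cfZA cf1Z cfZDr cfZDl.

(* [sup set0 = 0], so the norm of C(K) = {0} is right when K is empty. *)
Definition sup_norm (f : CK) : R := sup [set `|f x| | x in [set: K]].

Let has_ubound_cf (f : CK) : has_ubound [set `|f x| | x in [set: K]].
Proof.
have /compact_bounded[M [_ /(_ (M + 1))]] :
    compact ((f : K -> R) @` [set: K]).
  apply: continuous_compact; last exact: compact_space.
  by apply: continuous_subspaceT; exact: cf_continuous.
rewrite ltrDl ltr01 => /(_ isT) fM; exists (M + 1) => _ [x _ <-].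
by apply: fM; exists x.
Qed.

Lemma sup_norm_ge (f : CK) (x : K) : `|f x| <= sup_norm f.
Proof. by apply: ub_le_sup => //; exists x. Qed.

Lemma sup_norm_le (f : CK) (M : R) : 0 <= M ->
  (forall x, `|f x| <= M) -> sup_norm f <= M.
Proof.
move=> M0 fM; rewrite /sup_norm.
have [->|/set0P f0] := eqVneq [set `|f x| | x in [set: K]] set0.
  by rewrite sup0.
by apply: ge_sup => // _ [x _ <-].
Qed.

Let sup_norm_ge0 (f : CK) : 0 <= sup_norm f.
Proof.
rewrite /sup_norm.
have [->|/set0P[_ [x _ _]]] := eqVneq [set `|f x| | x in [set: K]] set0.
  by rewrite sup0.
exact: le_trans (sup_norm_ge f x).
Qed.

Let sup_normD (f g : CK) : sup_norm (f + g) <= sup_norm f + sup_norm g.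
Proof.
apply: sup_norm_le => [|x]; first by rewrite addr_ge0.
by apply: le_trans (ler_normD _ _) _; rewrite lerD // sup_norm_ge.
Qed.

Let sup_normZ (a : R) (f : CK) : sup_norm (a *: f) = `|a| * sup_norm f.
Proof.
have le_normZ (b : R) (g : CK) : sup_norm (b *: g) <= `|b| * sup_norm g.
  apply: sup_norm_le => [|x]; first by rewrite mulr_ge0.
  by rewrite [eval_cf _ _]/= normrM ler_wpM2l // sup_norm_ge.
apply/eqP; rewrite eq_le le_normZ /=.
have [->|a0] := eqVneq a 0; first by rewrite normr0 mul0r sup_norm_ge0.
by rewrite -ler_pdivlMl ?normr_gt0 // -normfV -[f in leLHS](scalerK a0) le_normZ.
Qed.

Let sup_norm0_eq0 (f : CK) : sup_norm f = 0 -> f = 0.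
Proof.
move=> f0; apply: cfP => x; apply/eqP.
by rewrite -normr_le0 -f0 sup_norm_ge.
Qed.

HB.instance Definition _ :=
  Lmodule_isNormed.Build R CK sup_normD sup_normZ sup_norm0_eq0.

Lemma normcfE (f : CK) : `|f| = sup [set `|f x| | x in [set: K]].
Proof. by []. Qed.

Let cf_complete (F : set_system CK) : ProperFilter F -> cauchy F -> cvg F.
Proof.
move=> FF Fc.
have Fball (e : R) : 0 < e -> exists f0 : CK, F (ball f0 e).
  by move=> e0; exact: (cauchyP F).1 Fc _ e0.
have eval_ball (f g : CK) (e : R) (x : K) : ball f e g -> `|f x - g x| <= e.
  by move=> fg; apply: le_trans (sup_norm_ge (f - g) x) _; exact: ltW fg.
have lP (x : K) : cvg ((fun f : CK => f x) @ F).
  apply: cauchy_cvg; apply/cauchy_exP => e e0.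
  have [f0 Ff0] := Fball (e / 2) (divr_gt0 e0 (ltr0n _ 2)).
  exists (f0 x); change (F [set f : CK | ball (f0 x) e (f x)]).
  apply: (filterS _ Ff0) => f /(@eval_ball _ _ _ x) f0f.
  rewrite /= -ball_normE /=.
  by apply: le_lt_trans f0f _; rewrite ltr_pdivrMr // ltr_pMr // ltr1n.
pose l (x : K) : R := lim ((fun f : CK => f x) @ F).
have lball (f0 : CK) (e : R) (x : K) : F (ball f0 e) -> `|f0 x - l x| <= e.
  move=> Ff0; have : closed_ball_ Num.norm (f0 x) e (l x).
    apply: (closed_cvg _ (@closed_closed_ball_ R R (f0 x) e) _ _ (lP x)).
    by apply: (filterS _ Ff0) => f /(@eval_ball _ _ _ x).
  by [].
have lc : continuous l.
  move=> x; apply/cvgrPdist_lt => e e0.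
  have e3 : 0 < e / 3 by rewrite divr_gt0.
  have [f0 Ff0] := Fball _ e3.
  have /cvgrPdist_lt/(_ _ e3) := @cf_continuous f0 x.
  apply: filterS => y f0xy.
  have := lball f0 _ x Ff0; have := lball f0 _ y Ff0 => h1 h2.
  rewrite (_ : l x - l y = (l x - f0 x) + (f0 x - f0 y) + (f0 y - l y)); last by ring.
  apply: le_lt_trans (ler_normD _ _) _.
  have := ler_normD (l x - f0 x) (f0 x - f0 y).
  by rewrite (distrC (l x) (f0 x)) => h3; lra.
apply/cvg_ex; exists (mkcf lc); apply/cvgrPdist_lt => e e0.
have e3 : 0 < e / 3 by rewrite divr_gt0.
have [f0 Ff0] := Fball _ e3.
apply: (filterS _ Ff0) => f f0f.
suff : `|mkcf lc - f| <= 2 * (e / 3) by move=> h; apply: le_lt_trans h _; lra.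
apply: sup_norm_le => [|x]; first by rewrite mulr_ge0 // ltW.
change (`|l x - f x| <= 2 * (e / 3)).
have h1 := lball f0 _ x Ff0; have h2 := @eval_ball _ _ _ x f0f.
have := ler_normD (l x - f0 x) (f0 x - f x).
by rewrite addrA subrK (distrC (l x) (f0 x)) => h3; lra.
Qed.

HB.instance Definition _ := Uniform_isComplete.Build CK cf_complete.

End continuous_fun.

Definition isomorphic (R : realType) (V W : normedModType R) :=
  exists (f : {linear V -> W}) (g : W -> V),
    [/\ cancel f g, cancel g f, continuous f & continuous g].

(* Main.v *)
From HB Require Import structures.
Require Import Defs.
From mathcomp Require Import all_boot all_order all_algebra.
From mathcomp Require Import all_classical all_reals.
From mathcomp Require Import topology normedtype.
From mathcomp Require Import lra.

Set Implicit Arguments.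
Unset Strict Implicit.
Unset Printing Implicit Defensive.

Import Order.TTheory GRing.Theory Num.Theory.
Import numFieldNormedType.Exports.

Local Open Scope classical_set_scope.
Local Open Scope card_scope.
Local Open Scope ring_scope.

(** Only the inequality chi(K) <= chi(L) needs proof, the situation being
symmetric.

The analytic ingredient is [countably_determined]: on a compact line, every
bounded functional mu on the continuous functions is determined by the values on
some countable set (the support of a measure on a compact line is separable).
Here this is proved without measures. A punctured neighbourhood of a point
carries arbitrarily little of mu, for otherwise disjointly supported functions
would make mu unbounded; by compactness, for each n there is a finite set such
that every convex set avoiding it carries at most 1/(n+1) of mu. A function
vanishing on the union of these finite sets is, up to a small uniform error, a
finite sum of pieces supported by convex sets that avoid the union.

Let kappa be an infinite cardinal bounding the characters of the points of L,
and let [f_i] be functions in C(K), indexed by a preorder in which kappa many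
elements always have an upper bound, such that each [f_i x] is eventually equal
to some [phi x]. Then phi is continuous ([eventual_limit_iso]). Indeed, with
T : C(K) -> C(L) the isomorphism, each functional [f |-> T f y] only sees
countably many points, so [T f_i y] is eventually equal to some [c y]; the limit
c is continuous because a discontinuity at y would already be visible on kappa
many points, on which some single [T f_i] agrees with c; and the same argument
for the inverse of T shows that phi is the preimage of c.

This bounds the character of a point x of K. If no family of kappa many points
is cofinal in the half-line below x, then the functions that are 0 up to a < x
and 1 from x on, indexed by a, have as eventual limit the indicator function of
the points from x on; its continuity makes x isolated from the left. So each
side of x has a base of size at most kappa, and kappa * kappa = kappa handles
both sides at once.

When L is infinite, its character is infinite, as some point is not isolated,
and kappa can be the character of L. When L is finite, K is finite by a
dimension count, and all its points have a base consisting of one set. *)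

(** * Bounded functionals on the continuous functions of a compact space *)

(** A property of sets that is inherited by subsets, stable under finite unions
and locally true holds for compact sets: otherwise the sets V such that A \ V
has the property form a proper filter without cluster point in A. *)
Lemma compact_set_ind (T : topologicalType) (A : set T) (P : set T -> Prop) :
  compact A -> P set0 -> (forall B C, B `<=` C -> P C -> P B) ->
  (forall B C, P B -> P C -> P (B `|` C)) ->
  (forall x, A x -> exists2 U, nbhs x U & P U) -> P A.
Proof.
move=> cA P0 PS PU Pnbhs; apply: contrapT => nPA.
pose F := [set V | P (A `\` V)].
have FF : ProperFilter F.
  split; first by rewrite /F /= setD0.
  split.
  - by rewrite /F /= setDT.
  - by move=> V W FV FW; rewrite /F /= setDIr; exact: PU.
  - by move=> V W VW; apply: PS; exact: setDS.
have [|x [Ax clFx]] := cA F FF; first by rewrite /F /= setDv.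
have [U xU PUx] := Pnbhs x Ax.
have FU : F (~` U) by apply: PS PUx; rewrite setDE setCK => z [].
by have [z []] := clFx _ _ FU xU.
Qed.

Lemma clampP (R : realDomainType) (eta r : R)
    (t := Num.max (- eta) (Num.min eta r)) :
  0 <= eta -> [/\ `|t| <= eta, `|r - t| <= `|r| & `|r| <= eta -> r - t = 0].
Proof.
rewrite /t => eta0; rewrite !ler_norml maxEle minEle; split.
- by case: ifPn; case: ifPn; rewrite -?ltNge => ? ?; apply/andP; split; lra.
- by case: ifPn; case: ifPn; rewrite -?ltNge => ? ?; case: (ger0P r) => ?;
    apply/andP; split; lra.
- by case: ifPn; case: ifPn; rewrite -?ltNge => ? ? /andP[? ?]; lra.
Qed.

Section functionals.
Variables (R : realType) (K : compactTopologicalType).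
Local Notation CK := (continuous_fun R K).

Lemma cfDE (f g : CK) x : eval_cf (f + g) x = f x + g x. Proof. by []. Qed.
Lemma cfNE (f : CK) x : eval_cf (- f) x = - f x. Proof. by []. Qed.
Lemma cfZE (a : R) (f : CK) x : eval_cf (a *: f) x = a * f x. Proof. by []. Qed.

Lemma normcf_le (f : CK) (M : R) :
  0 <= M -> (forall x, `|f x| <= M) -> `|f| <= M.
Proof. exact: sup_norm_le. Qed.

Lemma normcf_ge (f : CK) x : `|f x| <= `|f|.
Proof. exact: sup_norm_ge. Qed.

Definition vanishes_off (J : set K) (f : CK) := forall x, ~ J x -> f x = 0.

(** Functions can be approximated by functions that vanish near their zeros;
this replaces the inner regularity of a measure. *)
Lemma soft_threshold (g : CK) (eta : R) : 0 <= eta -> exists h : CK,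
  [/\ `|g - h| <= eta, forall x, `|h x| <= `|g x|
    & forall x, `|g x| <= eta -> h x = 0].
Proof.
move=> eta0.
have hc : continuous (fun x => g x - Num.max (- eta) (Num.min eta (g x))).
  move=> x; apply: (@cvgB _ R); first exact: cf_continuous.
  apply: (@continuous_max R K (fun=> - eta) (fun x => Num.min eta (g x))).
    exact: cvg_cst.
  apply: (@continuous_min R K (fun=> eta) g); first exact: cvg_cst.
  exact: cf_continuous.
exists (mkcf hc); split=> [|x|x].
- apply: normcf_le => // x; rewrite cfDE cfNE opprB addrC subrK.
  by have [] := clampP (g x) eta0.
- by have [] := clampP (g x) eta0.
- by have [] := clampP (g x) eta0.
Qed.

Variables (mu : {scalar CK}) (M : R).
Hypothesis mu_bounded : forall f, `|mu f| <= M * `|f|.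

(** The variation of mu on J is at most eps, in measure theoretic terms. *)
Definition small_on (eps : R) (J : set K) :=
  forall f, `|f| <= 1 -> vanishes_off J f -> `|mu f| <= eps.

Lemma small_on_null (J : set K) :
  (forall n : nat, small_on n.+1%:R^-1 J) ->
  forall f, vanishes_off J f -> mu f = 0.
Proof.
move=> Js f Jf; apply/eqP; rewrite -normr_le0.
have [->|f0] := eqVneq f 0; first by rewrite linear0 normr0.
have nf0 : 0 < `|f| by rewrite normr_gt0.
suff : `|mu (`|f|^-1 *: f)| <= 0.
  rewrite linearZ /= normrM normfV normr_id pmulr_rle0 //.
  by rewrite invr_gt0.
apply/ler_addgt0Pl => e e0; rewrite addr0.
have [n] := ltr_add_invr e0.
rewrite add0r => /ltW; apply: le_trans; apply: Js.
  by rewrite normrZ normfV normr_id mulVf ?gt_eqF.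
by move=> x /Jf fx; rewrite cfZE fx mulr0.
Qed.

(** Otherwise, given f supported by a neighbourhood of y and vanishing near y,
there is g with mu g > eps, supported by the set where f vanishes and vanishing
at y. Thresholding g makes it vanish near y, and f + g is again in the unit
ball. Repeating this yields values n * eps of mu on the unit ball. *)
Lemma punctured_nbhs_small (y : K) (eps : R) : 0 < eps ->
  exists2 U, nbhs y U & small_on eps (U `\ y).
Proof.
move=> eps0; apply: contrapT => nsmall.
have large (n : nat) (U : set K) : nbhs y U -> exists f : CK,
    [/\ `|f| <= 1, vanishes_off U f, nbhs y [set x | f x = 0]
      & n%:R * eps <= mu f].
  elim: n U => [|n IHn] U yU.
    exists 0; split; rewrite ?normr0 ?linear0 ?mul0r //.
    by rewrite (_ : [set _ | _] = setT); [exact: filterT|exact/seteqP].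
  have [f [f1 fU fy fmu]] := IHn U yU.
  have yV := filterI fy yU.
  have [g [g1 gV gmu]] : exists g : CK,
      [/\ `|g| <= 1, vanishes_off ((([set x | f x = 0]) `&` U) `\ y) g
        & eps < mu g].
    apply: contrapT => ng; apply: nsmall.
    exists ([set x | f x = 0] `&` U); first exact: yV.
    move=> g g1 gV.
    rewrite leNgt; apply/negP; have [_|_] := ger0P (mu g) => egmu; apply: ng.
      by exists g.
    exists (- g); rewrite normrN linearN; split=> // x /gV gx.
    by rewrite cfNE gx oppr0.
  have M0 : 0 <= M.
    have := mu_bounded g; have := ler_norm (mu g).
    have [_ _ | ] := leP 0 M; first by [].
    by have := normr_ge0 g; nra.
  (* Chosen so that M * eta < mu g - eps, the change of mu allowed to g. *)
  pose eta := (mu g - eps) / (M + 1).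
  have eta0 : 0 < eta by rewrite divr_gt0 ?subr_gt0 // ltr_wpDl.
  have [h [hg hleg h0]] := soft_threshold g (ltW eta0).
  have gy : g y = 0 by apply: gV => -[_]; exact.
  exists (f + h); split.
  - apply: normcf_le => // x; rewrite cfDE.
    have [fx|fx] := eqVneq (f x) 0.
      rewrite fx add0r; apply: le_trans (hleg x) _.
      exact: le_trans (normcf_ge g x) g1.
    have := hleg x; rewrite gV => [|[[/= fx0 _] _]]; last first.
      by rewrite fx0 eqxx in fx.
    rewrite normr0 normr_le0 => /eqP ->; rewrite addr0.
    exact: le_trans (normcf_ge f x) f1.
  - move=> x Ux; rewrite cfDE fU // add0r; apply/eqP.
    rewrite -normr_le0; apply: le_trans (hleg x) _.
    by rewrite gV ?normr0 // => -[[]].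
  - have gy0 : \forall x \near y, `|g x| <= eta.
      have /cvgr_dist_le/(_ _ eta0) : g x @[x --> y] --> g y.
        exact: cf_continuous.
      by rewrite gy; apply: filterS => x; rewrite sub0r normrN.
    apply: filterS2 fy gy0 => x fx /h0 hx.
    by change (eval_cf (f + h) x = 0); rewrite cfDE hx addr0; exact: fx.
  - rewrite linearD -natr1 mulrDl mul1r lerD //.
    have : `|mu (g - h)| <= M * eta.
      by apply: le_trans (mu_bounded _) _; rewrite ler_wpM2l.
    have : (M + 1) * eta = mu g - eps.
      by rewrite mulrC divfK // gt_eqF // ltr_wpDl.
    by rewrite linearB ler_norml => ? /andP[? ?] /=; lra.
pose n := (Num.truncn (M / eps)).+1.
have Mn : M < n%:R * eps by rewrite -ltr_pdivrMr //; exact: truncnS_gt.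
have n0 : 0 < n%:R * eps by rewrite mulr_gt0.
have [f [f1 _ _ nf]] := large n setT filterT.
have : n%:R * eps <= M * `|f|.
  exact: le_trans nf (le_trans (ler_norm _) (mu_bounded f)).
rewrite leNgt => /negP; apply.
have [M0|M0] := leP 0 M.
  by apply: le_lt_trans Mn; rewrite ler_piMr.
by apply: le_lt_trans n0; rewrite mulr_le0_ge0 // ltW.
Qed.

End functionals.

(** * Functionals on a compact line are determined by countably many points *)

Section order_nbhs.
Context {d : Order.disp_t} {L : orderTopologicalType d}.

(** Open intervals; None stands for a missing endpoint. *)
Definition box (a b : option L) : set L :=
  [set z | oapp (fun s => (s < z)%O) true a &&
    oapp (fun t => (z < t)%O) true b].

Lemma box_open (a b : option L) : open (box a b).
Proof.
rewrite (_ : box a b = [set z | oapp (fun s => (s < z)%O) true a] `&`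
    [set z | oapp (fun t => (z < t)%O) true b]); last first.
  by apply/seteqP; split => z /andP.
apply: openI.
  case: a => [s|] /=; last first.
    by rewrite (_ : [set _ | _] = setT); [exact: openT|exact/seteqP].
  rewrite (_ : [set _ | _] = `]s, +oo[%classic); first exact: rray_open.
  by apply/seteqP; split => z; rewrite /= in_itv /= andbT.
case: b => [t|] /=; last first.
  by rewrite (_ : [set _ | _] = setT); [exact: openT|exact/seteqP].
rewrite (_ : [set _ | _] = `]-oo, t[%classic); first exact: lray_open.
by apply/seteqP; split => z; rewrite /= in_itv.
Qed.

Lemma nbhs_box (x : L) (U : set L) : nbhs x U ->
  exists a b : option L, box a b x /\ box a b `<=` U.
Proof.
rewrite itv_nbhsE => -[[l r] [iopen xi] iU].
have [a la] : exists a : option L, l = oapp (fun s => BRight s) -oo%O a.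
  case: l iopen {xi iU} =>
    [b s /itv_open_ends_lside ->|b /itv_open_ends_linfty ->].
    by exists (Some s).
  by exists None.
have [b rb] : exists b : option L, r = oapp (fun s => BLeft s) +oo%O b.
  case: r iopen {xi iU} =>
    [b s /itv_open_ends_rside ->|b /itv_open_ends_rinfty ->].
    by exists (Some s).
  by exists None.
have boxE z : z \in Interval l r = oapp (fun s => (s < z)%O) true a &&
    oapp (fun t => (z < t)%O) true b.
  by rewrite la rb; case: (a) (b) => [s|] [t|]; rewrite in_itv.
exists a, b; split=> [|z boxz]; first by rewrite /box /= -boxE.
by apply: iU; rewrite /= boxE.
Qed.

Definition convex_set (J : set L) :=
  forall x y z, J x -> J z -> (x <= y)%O -> (y <= z)%O -> J y.

(** D consists of the endpoints of V: a convex set that meets V can only leave V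
through one of them. *)
Lemma convex_trap (x : L) (U : set L) : nbhs x U -> exists V D : set L,
  [/\ nbhs x V, V `<=` U, finite_set D & forall J, convex_set J ->
    J `&` D = set0 -> J `&` V !=set0 -> J `<=` V].
Proof.
move=> /nbhs_box[a [b [xab abU]]].
exists (box a b), ([set s | a = Some s] `|` [set t | b = Some t]); split=> //.
- by apply: open_nbhs_nbhs; split=> //; exact: box_open.
- have fin (o : option L) : finite_set [set s | o = Some s].
    case: o => [s|]; last first.
      by rewrite (_ : [set _ | _] = set0) //; apply/seteqP; split.
    by apply: sub_finite_set (finite_set1 s) => t [->].
  by rewrite finite_setU.
- move=> J Jc JD [p [Jp /andP[ap pb]]] z Jz.
  have nJ s : a = Some s \/ b = Some s -> ~ J s.
    by move=> abs Js; rewrite -[False]/(set0 s) -JD.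
  apply/andP; split.
    case: (a) nJ ap => [s|] //= nJ sp; rewrite ltNge; apply/negP => zs.
    by apply: (nJ s); [left|exact: (Jc z s p Jz Jp zs (ltW sp))].
  case: (b) nJ pb => [t|] //= nJ pt; rewrite ltNge; apply/negP => tz.
  by apply: (nJ t); [right|exact: (Jc p t z Jp Jz (ltW pt) tz)].
Qed.

End order_nbhs.

Section countably_determined.
Context {R : realType} {d : Order.disp_t} {L : compactLineType d}.
Local Notation CL := (continuous_fun R L).

(** The convex component of p in the set where e does not vanish. *)
Definition component (e : CL) (p : L) : set L :=
  [set z | forall y, (Order.min p z <= y <= Order.max p z)%O -> e y != 0].

Lemma component_convex (e : CL) p : convex_set (component e p).
Proof.
move=> x y z ex ez xy yz t /andP[pyt tpy].
have [tp|pt] := leP t p.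
  apply: ex; rewrite ge_min le_max tp /= andbT.
  by move: pyt; rewrite ge_min => /orP[->//|yt]; rewrite (le_trans xy yt) orbT.
apply: ez; rewrite ge_min le_max (ltW pt) /=.
move: tpy; rewrite le_max (leNgt t p) pt /= => ty.
exact: le_trans ty yz.
Qed.

Lemma component_neq0 (e : CL) p z : component e p z -> e z != 0.
Proof. by apply; rewrite ge_min le_max lexx !orbT. Qed.

Lemma component_trans (e : CL) p q z :
  component e p q -> component e q z -> component e p z.
Proof.
move=> pq qz y /andP[y1 y2].
have [yq|qy] := leP y q.
  have [py|yp] := leP p y; first by apply: pq; rewrite ge_min le_max py yq orbT.
  apply: qz; rewrite ge_min le_max yq /= andbT.
  by move: y1; rewrite ge_min leNgt yp /= => ->; rewrite orbT.
have [yp|py] := leP y p.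
  by apply: pq; rewrite ge_min le_max yp (ltW qy) orbT.
apply: qz; rewrite ge_min le_max (ltW qy) /=.
by move: y2; rewrite le_max (leNgt y p) py /= => ->; rewrite orbT.
Qed.

Lemma component_sym (e : CL) p q : component e p q -> component e q p.
Proof. by move=> pq y; rewrite minC maxC; exact: pq. Qed.

Lemma component_nbhs (e : CL) z : e z != 0 -> nbhs z (component e z).
Proof.
move=> ez; have : nbhs z [set y | e y != 0].
  exact: (@cvgr_neq0 R R L (nbhs z) _ e (e z) (@cf_continuous R L e z) ez).
move=> /nbhs_box[a [b [zab abe]]].
have : nbhs z (box a b) by apply: open_nbhs_nbhs; split=> //; exact: box_open.
apply: filterS => y yab t /andP[t1 t2]; apply: abe.
move: zab yab => /andP[az zb] /andP[ay yb]; apply/andP; split.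
  case: (a) az ay => [s|] //= sz sy.
  by apply: lt_le_trans t1; rewrite lt_min sz.
case: (b) zb yb => [s|] //= sz sy.
by apply: le_lt_trans t2 _; rewrite gt_max sz.
Qed.

(** The components of the set where e does not vanish are open and pairwise
disjoint, so that cutting h off outside a component creates no discontinuity
where e does not vanish; where e vanishes, h is small. *)
Lemma restrict_component (e h : CL) p : (forall x, e x = 0 -> h x = 0) ->
  exists h' : CL, forall x, h' x = if x \in component e p then h x else 0.
Proof.
move=> eh.
have hc : continuous (fun x => if x \in component e p then h x else 0).
  move=> x; have [ex|ex] := eqVneq (e x) 0.
    rewrite /continuous_at [X in _ --> X](_ : _ = 0); last first.
      by rewrite eh // if_same.
    apply/cvgr0Pnorm_lt => eps eps0.
    have /cvgr0Pnorm_lt/(_ _ eps0) : h y @[y --> x] --> 0.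
      by rewrite -(eh _ ex); exact: cf_continuous.
    by apply: filterS => y hy; case: ifP => // _; rewrite normr0.
  have same : \forall y \near x,
      (if x \in component e p then h y else 0) =
      (if y \in component e p then h y else 0).
    have := component_nbhs ex; apply: filterS => y xy.
    suff -> : (x \in component e p) = (y \in component e p) by [].
    apply/idP/idP; rewrite !inE => pz; first exact: component_trans xy.
    exact: component_trans (component_sym xy).
  apply: cvg_trans (near_eq_cvg same) _.
  by case: ifP => _; [exact: cf_continuous|exact: cvg_cst].
by exists (mkcf hc).
Qed.

Variables (mu : {scalar CL}) (M : R).
Hypothesis mu_bounded : forall f, `|mu f| <= M * `|f|.

(** A convex set that meets a neighbourhood V of x as in [convex_trap] and
avoids x and the endpoints of V is contained in V minus x. *)
Lemma finite_trap (eps : R) : 0 < eps -> exists2 D : set L, finite_set D &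
  forall J, convex_set J -> J `&` D = set0 -> small_on mu eps J.
Proof.
move=> eps0.
pose P (A : set L) := exists2 D : set L, finite_set D & forall J,
  convex_set J -> J `&` D = set0 -> J `&` A !=set0 -> small_on mu eps J.
suff [D Dfin DP] : P setT.
  exists D => // J Jc JD f f1 Jf.
  have [/set0P[p Jp]|J0] := boolP (J != set0).
    by apply: (DP J) => //; exists p.
  rewrite (_ : f = 0) ?linear0 ?normr0 ?ltW //; apply: cfP => x.
  by rewrite Jf //; move: J0; rewrite negbK => /eqP ->.
apply: compact_set_ind; first exact: compact_space.
- by exists set0 => // J _ _ [x []].
- move=> B C BC [D Dfin DP]; exists D => // J Jc JD [x [Jx Bx]].
  by apply: DP => //; exists x; split=> //; exact: BC.
- move=> B C [D Dfin DP] [E Efin EP]; exists (D `|` E).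
    by rewrite finite_setU.
  move=> J Jc; rewrite setIUr setU_eq0 => -[JD JE] [x [Jx [Bx|Cx]]].
    by apply: DP => //; exists x.
  by apply: EP => //; exists x.
move=> x _.
have [U xU Usmall] := punctured_nbhs_small mu_bounded x eps0.
have [V [D [xV VU Dfin VD]]] := convex_trap xU.
exists V => //; exists (D `|` [set x]).
  by rewrite finite_setU.
move=> J Jc; rewrite setIUr setU_eq0 => -[JD Jx] /(VD _ Jc JD) JV f f1 Jf.
apply: Usmall => // y nUy; apply: Jf => Jy; apply: nUy; split.
  exact/VU/JV.
by move=> yx; rewrite -[False]/(set0 x) -Jx; split=> //; rewrite -yx.
Qed.

(** D is the union of the finite sets that trap convex sets of small variation.
If e vanishes on D, then each component of the set where e does not vanish
avoids D, hence is null for mu. Only finitely many components meet the compact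
set where |e| >= eta, which carries the soft threshold of e. *)
Theorem countably_determined : exists2 D : set L, countable D &
  forall e : CL, (forall z, D z -> e z = 0) -> mu e = 0.
Proof.
have inv0 (n : nat) : 0 < (n.+1%:R : R)^-1 by rewrite invr_gt0 ltr0n.
have /choice[D_ D_P] (n : nat) : exists D : set L, finite_set D /\ forall J,
    convex_set J -> J `&` D = set0 -> small_on mu n.+1%:R^-1 J.
  by have [D ? ?] := finite_trap (inv0 n); exists D.
pose D := \bigcup_n D_ n.
exists D.
  apply: bigcup_countable => // n _; apply: finite_set_countable.
  exact: (D_P n).1.
move=> e De.
have Dnull J : convex_set J -> J `&` D = set0 ->
    forall f, vanishes_off J f -> mu f = 0.
  move=> Jc JD f; apply: small_on_null => n.
  apply: (D_P n).2 => //; rewrite -subset0 -JD => x [Jx Dx].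
  by split=> //; exists n.
(* On A, functions that vanish where e does can be erased, mu unchanged. *)
pose P (A : set L) := forall h : CL, (forall x, e x = 0 -> h x = 0) ->
  exists h' : CL, [/\ mu h' = mu h, forall x, h x = 0 -> h' x = 0
    & forall x, A x -> h' x = 0].
have Pbig (eta : R) : 0 < eta -> P [set x | eta <= `|e x|].
  move=> eta0; apply: compact_set_ind.
  - apply: (subclosed_compact _ compact_space) => //.
    apply: (closed_comp (f := fun x => `|e x|) (D := [set y | eta <= y])).
      by move=> x _; apply: (@cvg_norm _ R); exact: cf_continuous.
    exact: closed_ge.
  - by move=> h _; exists h.
  - move=> B C BC PC h eh; have [h' [? ? Ch']] := PC h eh.
    by exists h'; split=> // x /BC; exact: Ch'.
  - move=> B C PB PC h eh; have [h1 [mu1 h01 B1]] := PB h eh.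
    have [|h2 [mu2 h02 C2]] := PC h1; first by move=> x /eh /h01.
    exists h2; split=> [|x /h01/h02//|x [/B1/h02//|/C2//]].
    by rewrite mu2.
  move=> z /= ez; have ez0 : e z != 0.
    by rewrite -normr_gt0; apply: lt_le_trans ez.
  exists (component e z); first exact: component_nbhs.
  move=> h eh; have [g hg] := restrict_component z eh.
  exists (h - g); split.
  - rewrite linearB /= [X in _ - X](_ : _ = 0) ?subr0 //.
    apply: (Dnull _ (@component_convex e z)).
      rewrite -subset0 => x [/component_neq0 ex Dx].
      by rewrite De ?eqxx in ex.
    by move=> x nx; rewrite hg memNset.
  - by move=> x hx; rewrite cfDE cfNE hg hx if_same subrr.
  - by move=> x xe; rewrite cfDE cfNE hg mem_set // subrr.
apply/eqP; rewrite -normr_le0; apply/ler_addgt0Pl => eps eps0; rewrite addr0.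
have M1 : 0 < `|M| + 1 by rewrite ltr_wpDl.
pose eta := eps / (`|M| + 1).
have eta0 : 0 < eta by rewrite divr_gt0.
have [h [eh hle h0]] := soft_threshold e (ltW eta0).
have [|g [muh hg gbig]] := Pbig _ eta0 h.
  by move=> x ex; apply: h0; rewrite ex normr0 ltW.
have g0 : g = 0.
  apply: cfP => x; have [ex|ex] := leP eta `|e x|; first by rewrite gbig.
  by rewrite hg // h0 // ltW.
rewrite (_ : mu e = mu (e - h)); last first.
  by rewrite linearB /= -muh g0 linear0 subr0.
apply: le_trans (mu_bounded _) _.
have Mle : M <= `|M| + 1 by apply: le_trans (ler_norm M) _; rewrite lerDl.
apply: le_trans (ler_wpM2r (normr_ge0 _) Mle) _.
rewrite (_ : eps = (`|M| + 1) * eta); first exact: ler_wpM2l (ltW M1) _ _ eh.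
by rewrite mulrC divfK // gt_eqF.
Qed.

End countably_determined.

(** * Eventual limits along highly directed families *)

Section evaluation.
Context {R : realType} {K L : compactTopologicalType}.
Local Notation CK := (continuous_fun R K).
Local Notation CL := (continuous_fun R L).
Variables (T : {linear CK -> CL}) (y : L).

(** A name for the functional, to carry its linear structure. *)
Definition eval_linear (f : CK) : R := T f y.

Let eval_linear_is_linear : linear_for *%R eval_linear.
Proof. by move=> a f g; rewrite /eval_linear linearP. Qed.

HB.instance Definition _ :=
  GRing.isLinear.Build R CK R *%R eval_linear eval_linear_is_linear.

Lemma eval_linear_bounded : continuous T ->
  exists M, forall f, `|eval_linear f| <= M * `|f|.
Proof.
move=> /linear_bounded_continuous/linear_boundedP/pinfty_ex_gt0[M M0 TM].
by exists M => f; apply: le_trans (normcf_ge _ _) (TM f).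
Qed.

End evaluation.

Lemma operator_countably_determined (R : realType) d (K : compactLineType d)
    (L : compactTopologicalType)
    (T : {linear continuous_fun R K -> continuous_fun R L}) (y : L) :
  continuous T -> exists2 D : set K, countable D &
    forall e : continuous_fun R K, (forall z, D z -> e z = 0) -> T e y = 0.
Proof.
by move=> /(eval_linear_bounded y)[M TM]; exact: countably_determined TM.
Qed.

Section directed.
Context {U I : Type} (kappa : set U) (le : I -> I -> Prop).

(** kappa^+ - directedness of the index set. *)
Definition bounded_families :=
  forall S : set I, S #<= kappa -> exists j, forall i, S i -> le i j.

Definition eventually_equal (X Y : Type) (f : I -> X -> Y) (phi : X -> Y) :=
  forall x, exists i, forall j, le i j -> f j x = phi x.

Hypothesis le_trans : forall i j k, le i j -> le j k -> le i k.
Hypothesis bounded : bounded_families.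

(** The point of kappa^+ - directedness: eventual equality, assumed at each
point, becomes uniform on sets of size at most kappa. *)
Lemma eventually_equal_on (X Y : Type) (f : I -> X -> Y) (phi : X -> Y)
    (D : set X) :
  D #<= kappa -> eventually_equal f phi ->
  exists i, forall j, le i j -> forall x, D x -> f j x = phi x.
Proof.
move=> Dk /choice[i_ iP].
have [|i0 i0P] := @bounded (i_ @` D).
  exact: card_le_trans (card_image_le _ _) Dk.
exists i0 => j i0j x Dx; apply: iP; apply: le_trans i0j.
by apply: i0P; exists x.
Qed.

End directed.

Section isomorphism.
Context {R : realType} {d1 d2 : Order.disp_t}.
Context {K : compactLineType d1} {L : compactLineType d2}.
Local Notation CK := (continuous_fun R K).
Local Notation CL := (continuous_fun R L).
Variables (T : {linear CK -> CL}) (S : {linear CL -> CK}).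
Hypothesis TK : cancel T S.
Hypotheses (Tcont : continuous T) (Scont : continuous S).

Context {U : Type} (kappa : set U).
Hypothesis kappa_infinite : infinite_set kappa.
Hypothesis L_character : forall y : L, min_local_base y #<= kappa.

Context {I : Type} (le : I -> I -> Prop).
Hypothesis le_trans : forall i j k, le i j -> le j k -> le i k.
Hypothesis bounded : bounded_families kappa le.

Let countable_le (X : Type) (D : set X) : countable D -> D #<= kappa.
Proof. by move=> Dc; apply: card_le_trans Dc _; exact/infiniteP. Qed.

(** The functional [f |-> T f y] does not distinguish functions that agree on
some countable set, and on that set the f_i eventually agree with each other. *)
Lemma eventually_equal_operator (f : I -> CK) (phi : K -> R) :
  eventually_equal le (fun i => eval_cf (f i)) phi ->
  exists c : L -> R, eventually_equal le (fun i => eval_cf (T (f i))) c.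
Proof.
move=> fphi.
suff /choice[c cP] y :
    exists r, exists i, forall j, le i j -> T (f j) y = r.
  by exists c.
have [D Dcount TD] := operator_countably_determined y Tcont.
have [i iP] := eventually_equal_on le_trans bounded (countable_le Dcount) fphi.
have [|j0 ij0] := @bounded [set i].
  by apply: countable_le; exact: finite_set_countable.
have {}ij0 := ij0 i erefl.
exists (T (f j0) y), j0 => j j0j; apply/eqP; rewrite -subr_eq0; apply/eqP.
have : T (f j - f j0) y = 0.
  apply: TD => z Dz; rewrite cfDE cfNE iP ?(iP j0) ?subrr //.
  exact: le_trans j0j.
by rewrite linearB.
Qed.

(** A discontinuity of c at y is witnessed by one point in each member of a base
at y. These points and y are at most kappa many, so c agrees on all of them with
one continuous [f j]. *)
Lemma eventual_limit_continuous (f : I -> CL) (c : L -> R) :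
  eventually_equal le (fun i => eval_cf (f i)) c -> continuous c.
Proof.
move=> fc y; apply: contrapT => /cvgrPdist_lt; apply; move=> eps eps0.
have [[Bsub Bbase] _] := min_local_baseP y.
apply: contrapT => nnear.
have far V : exists z, min_local_base y V -> V z /\ ~ `|c y - c z| < eps.
  have [BV|nBV] := pselect (min_local_base y V); last by exists y => /nBV.
  apply: contrapT => nfar; apply: nnear.
  have [Vo Vy] := Bsub V BV.
  apply: filterS (open_nbhs_nbhs (conj Vo Vy)) => z Vz.
  by apply: contrapT => nc; apply: nfar; exists z => _; split.
move: far => /choice[z_ zP].
have [i iP] : exists i, forall j, le i j -> forall x,
    (z_ @` min_local_base y) x -> f j x = c x.
  apply: (eventually_equal_on le_trans bounded _ fc).
  exact: card_le_trans (card_image_le _ _) (L_character y).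
have [i' i'P] : exists i, forall j, le i j ->
    forall x, [set y] x -> f j x = c x.
  apply: (eventually_equal_on le_trans bounded _ fc).
  by apply: countable_le; exact: finite_set_countable.
have [|j jP] := @bounded ([set i] `|` [set i']).
  by apply: countable_le; apply: finite_set_countable; rewrite finite_setU.
have [V BV Vfj] : filter_from (min_local_base y) id
    [set z | `|f j y - f j z| < eps].
  apply: Bbase; have /cvgrPdist_lt/(_ _ eps0) := @cf_continuous _ _ (f j) y.
  by [].
have [/Vfj /= + nfar] := zP V BV.
have fjy : f j y = c y by apply: i'P => //; apply: jP; right.
have fjz : f j (z_ V) = c (z_ V).
  by apply: (iP j (jP i (or_introl erefl))); exists V.
by rewrite fjy fjz.
Qed.

(** The functions T f_i have a continuous eventual limit c. Functionals on C(L)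
being countably determined too, [f_i x] is eventually equal to the value at x
of the preimage of c. *)
Theorem eventual_limit_iso (f : I -> CK) (phi : K -> R) :
  eventually_equal le (fun i => eval_cf (f i)) phi -> continuous phi.
Proof.
move=> fphi; have [c Tfc] := eventually_equal_operator fphi.
have cc := eventual_limit_continuous Tfc.
suff <- : eval_cf (S (mkcf cc)) = phi by exact: cf_continuous.
apply/funext => x.
have [D Dcount SD] := operator_countably_determined x Scont.
have [i iP] := eventually_equal_on le_trans bounded (countable_le Dcount) Tfc.
have [i' i'P] := fphi x.
have [|j jP] := @bounded ([set i] `|` [set i']).
  by apply: countable_le; apply: finite_set_countable; rewrite finite_setU.
rewrite -(i'P j); last by apply: jP; right.
apply/eqP; rewrite -subr_eq0; apply/eqP.
have : S (mkcf cc - T (f j)) x = 0.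
  apply: SD => z Dz; rewrite cfDE cfNE (iP j) ?subrr //.
  by apply: jP; left.
by rewrite linearB /= TK.
Qed.

End isomorphism.

(** * Squares of infinite cardinals *)

Lemma inj_on_card_le (X Y : Type) (A : set X) (B : set Y) (f : X -> Y) :
  (forall x, A x -> B (f x)) ->
  (forall x y, A x -> A y -> f x = f y -> x = y) -> A #<= B.
Proof.
move=> AB finj; have fA : f @` A #= A.
  by apply: inj_card_eq => x y; rewrite !inE => Ax Ay; exact: finj.
rewrite -(card_le_eql fA); apply: subset_card_le => _ [x Ax <-]; exact: AB.
Qed.

Lemma card_le_inj_on (X Y : Type) (A : set X) (B : set Y) (y0 : Y) : A #<= B ->
  exists f : X -> Y, (forall x, A x -> B (f x)) /\
    (forall x y, A x -> A y -> f x = f y -> x = y).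
Proof.
move=> /card_leP[f].
exists (fun x =>
  if pselect (A x) is left Ax then val (f (SigSub (mem_set Ax))) else y0).
split=> [x Ax|x y Ax Ay].
  by case: pselect => // Ax'; exact: (set_valP (f _)).
case: pselect => // Ax'; case: pselect => // Ay' /val_inj.
by move=> /(@inj _ _ _ f _ _ (in_setT _) (in_setT _)) /(congr1 val).
Qed.

Lemma card_le_setX (X X' Y Y' : Type) (A : set X) (A' : set X') (B : set Y)
    (B' : set Y') : A #<= B -> A' #<= B' -> A `*` A' #<= B `*` B'.
Proof.
move=> AB AB'.
have [->|/set0P[[a a'] [/= Aa Aa']]] := eqVneq (A `*` A') set0.
  exact: card_ge0.
have nonempty (V W : Type) (C : set V) (D : set W) c :
    C c -> C #<= D -> D !=set0.
  move=> Cc CD; apply/set0P; apply/negP => /eqP D0; move: CD; rewrite D0.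
  by move=> /card_le0P C0; rewrite C0 in Cc.
have [b _] := nonempty _ _ _ _ _ Aa AB.
have [b' _] := nonempty _ _ _ _ _ Aa' AB'.
have [g [gB ginj]] := card_le_inj_on b AB.
have [g' [gB' ginj']] := card_le_inj_on b' AB'.
apply: (@inj_on_card_le _ _ _ _ (fun p => (g p.1, g' p.2))).
  by move=> [x y] [/= Ax Ay]; split; [exact: gB|exact: gB'].
move=> [x y] [z t] [/= Ax Ay] [/= Az At] [gxz gyt].
by rewrite (ginj x z Ax Az gxz) (ginj' y t Ay At gyt).
Qed.

Section square.
Context {U : Type}.
Implicit Types (S A B : set U) (f : U -> U -> U).

(** f restricts to an injection of S * S into S. A total f avoids functions on a
varying domain in the use of Zorn's lemma. *)
Definition pairing S f := (forall x y, S x -> S y -> S (f x y)) /\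
  forall x y x' y', S x -> S y -> S x' -> S y' ->
    f x y = f x' y' -> x = x' /\ y = y'.

Lemma pairing_card_le S f : pairing S f -> S `*` S #<= S.
Proof.
move=> [fS finj]; apply: (@inj_on_card_le _ _ _ _ (fun p => f p.1 p.2)).
  by move=> [x y] [/= Sx Sy]; exact: fS.
by move=> [x y] [x' y'] [/= Sx Sy] [/= Sx' Sy'] /finj[] // -> ->.
Qed.

Lemma pairing_countable A : infinite_set A -> exists S f s0 s1,
  [/\ S `<=` A, pairing S f, S s0, S s1 & s0 <> s1].
Proof.
move=> Ainf; have [a _] := infinite_setN0 Ainf.
have /(card_le_inj_on a)[g [gA ginj]] : [set: nat] #<= A by exact/infiniteP.
pose ginv x := xget 0%N [set n | g n = x].
have gK n : ginv (g n) = n.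
  rewrite /ginv; case: xgetP => [m _ /(ginj m n I I)//|/(_ n) []].
  by [].
exists (range g), (fun x y => g (pickle (ginv x, ginv y))), (g 0%N), (g 1%N).
split.
- by move=> _ [n _ <-]; exact: gA.
- split=> [x y _ _|_ _ _ _ [x _ <-] [y _ <-] [x' _ <-] [y' _ <-]].
    by exists (pickle (ginv x, ginv y)).
  rewrite !gK => /(ginj _ _ I I) /(pcan_inj pickleK) [-> ->].
  by [].
- by exists 0%N.
- by exists 1%N.
- by move=> /(ginj _ _ I I).
Qed.

(** Two points s0, s1 of S serve as tags: x in S is coded as the pair (s0, x),
and x outside S as the pair (s1, g x). *)
Lemma pairing_double S B f s0 s1 : pairing S f -> S s0 -> S s1 -> s0 <> s1 ->
  B #<= S -> exists e : U -> U, (forall x, (S `|` B) x -> S (e x)) /\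
    (forall x y, (S `|` B) x -> (S `|` B) y -> e x = e y -> x = y).
Proof.
move=> [fS finj] Ss0 Ss1 s01 /(card_le_inj_on s0)[g [gS ginj]].
exists (fun x => if pselect (S x) then f s0 x else f s1 (g x)); split.
  by move=> x; case: pselect => Sx xSB; apply: fS => //; apply: gS; case: xSB.
move=> x y; case: pselect => Sx xSB; case: pselect => Sy ySB.
- by move=> /finj[].
- have Sgy : S (g y) by apply: gS; case: ySB.
  by move=> /finj[] // /s01.
- have Sgx : S (g x) by apply: gS; case: xSB.
  by move=> /finj[] // /esym/s01.
- have Bx : B x by case: xSB.
  have By : B y by case: ySB.
  by move=> /(finj _ _ _ _ Ss1 (gS x Bx) Ss1 (gS y By))[_]; exact: ginj.
Qed.

(** With S' a disjoint copy g(S) of S, the pairs of the union of S and S' that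
are not in S * S are first coded in S, then sent to S' by g. *)
Lemma pairing_extend A S f s0 s1 : S `<=` A -> pairing S f -> S s0 -> S s1 ->
  s0 <> s1 -> S #<= A `\` S -> exists S' f', [/\ S `<=` S', S' `<=` A,
    ~ S' `<=` S, pairing S' f' & forall x y, S x -> S y -> f' x y = f x y].
Proof.
move=> SA pf Ss0 Ss1 s01 /(card_le_inj_on s0)[g [gA ginj]].
have [|e [eS einj]] := @pairing_double S (g @` S) f s0 s1 pf Ss0 Ss1 s01.
  exact: card_image_le.
have [fS finj] := pf.
exists (S `|` g @` S), (fun x y =>
  if pselect (S x /\ S y) then f x y else g (f (e x) (e y))).
split.
- by move=> x; left.
- by move=> x [/SA//|[y Sy <-]]; exact: (gA y Sy).1.
- by move=> /(_ (g s0)) gs; apply: (gA s0 Ss0).2; apply: gs; right; exists s0.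
- split=> [x y xS yS|x y x' y' xS yS xS' yS'].
    case: pselect => [[Sx Sy]|nS]; first by left; exact: fS.
    by right; exists (f (e x) (e y)) => //; apply: fS; exact: eS.
  have Sg z z' : S z -> S z' -> g z <> z'.
    by move=> Sz Sz' gz; apply: (gA z Sz).2; rewrite gz.
  have See : S (f (e x) (e y)) by apply: fS; exact: eS.
  have See' : S (f (e x') (e y')) by apply: fS; exact: eS.
  case: pselect => [[Sx Sy]|nS]; case: pselect => [[Sx' Sy']|nS'].
  + exact: finj.
  + by move/esym/Sg => H; case: H => //; exact: fS.
  + by move/Sg => H; case: H => //; exact: fS.
  + move=> /(ginj _ _ See See').
    move=> /(finj _ _ _ _ (eS _ xS) (eS _ yS) (eS _ xS') (eS _ yS')).
    by move=> [/einj-> // /einj->].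
- by move=> x y Sx Sy; case: pselect => // -[].
Qed.

(** Take a maximal pairing (S, f) above a countable one. If A \ S were at least
as large as S, the pairing could be extended; so A \ S embeds into S, hence A
embeds into two copies of S, and S is as large as A. *)
Lemma card_le_square A : infinite_set A -> A `*` A #<= A.
Proof.
move=> Ainf.
have [S0 [f0 [s0 [s1 [S0A pf0 S0s0 S0s1 s01]]]]] := pairing_countable Ainf.
pose good (p : set U * (U -> U -> U)) :=
  [/\ S0 `<=` p.1, p.1 `<=` A & pairing p.1 p.2].
pose extendsP (p q : {p | good p}) := (sval p).1 `<=` (sval q).1 /\
  forall x y, (sval p).1 x -> (sval p).1 y -> (sval p).2 x y = (sval q).2 x y.
pose extends p q := `[< extendsP p q >].
have refl p : extends p p by apply/asboolP; split.
have trans p q r : extends p q -> extends q r -> extends p r.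
  move=> /asboolP[pq fpq] /asboolP[qr fqr].
  apply/asboolP; split=> [x /pq/qr//|x y px py].
  by rewrite fpq // fqr //; exact: pq.
have good0 : good (S0, f0) by split.
have [|[[S f] [/= S0S SA pf]] Smax] := ZL_preorder (exist _ _ good0) refl trans.
  move=> F Ftot.
  have [[p0 Fp0]|F0] := pselect (exists p, F p); last first.
    by exists (exist _ _ good0) => p Fp; exfalso; apply: F0; exists p.
  pose S := \bigcup_(p in F) (sval p).1.
  have joint x y : S x -> S y ->
      exists p, [/\ F p, (sval p).1 x & (sval p).1 y].
    move=> [p Fp px] [q Fq qy].
    have [/asboolP[pq _]|/asboolP[qp _]] := Ftot p q Fp Fq.
      by exists q; split=> //; exact: pq.
    by exists p; split=> //; exact: qp.
  have /choice[f fP] (xy : U * U) : exists z, forall p, F p ->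
      (sval p).1 xy.1 -> (sval p).1 xy.2 -> z = (sval p).2 xy.1 xy.2.
    case: xy => x y /=.
    have [[p [Fp px py]]|np] :=
        pselect (exists p, [/\ F p, (sval p).1 x & (sval p).1 y]).
      exists ((sval p).2 x y) => q Fq qx qy.
      by have [/asboolP[_ ->//]|/asboolP[_ <-//]] := Ftot p q Fp Fq.
    by exists x => p Fp px py; case: np; exists p.
  have gf : good (S, fun x y => f (x, y)).
    split => /=.
    - by move=> x S0x; exists p0 => //; have [/(_ _ S0x)] := svalP p0.
    - by move=> x [p Fp px]; have [_ pA _] := svalP p; exact: pA.
    - split=> [x y Sx Sy|x y x' y' Sx Sy Sx' Sy'].
        have [p [Fp px py]] := joint x y Sx Sy; exists p => //.
        by rewrite (fP (x, y) p) //=; have [_ _ [fp _]] := svalP p; exact: fp.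
      have [p [Fp px py]] := joint x y Sx Sy.
      have [q [Fq qx' qy']] := joint x' y' Sx' Sy'.
      have [r [Fr [rx ry rx' ry']]] : exists r, F r /\
          [/\ (sval r).1 x, (sval r).1 y, (sval r).1 x' & (sval r).1 y'].
        have [/asboolP[pq _]|/asboolP[qp _]] := Ftot p q Fp Fq.
          by exists q; split=> //; split=> //; exact: pq.
        by exists p; split=> //; split=> //; exact: qp.
      rewrite (fP (x, y) r) // (fP (x', y') r) //=.
      by have [_ _ [_ fr]] := svalP r; exact: fr.
  exists (exist _ _ gf) => p Fp.
  apply/asboolP; split=> /= [x px|x y px py]; first by exists p.
  by rewrite (fP (x, y) p).
have Ss0 := S0S s0 S0s0; have Ss1 := S0S s1 S0s1.
have AS : A #<= S.
  have [SAS|ASS] := card_le_total S (A `\` S).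
    have [S' [f' [SS' S'A S'S pf' f'f]]] :=
      pairing_extend SA pf Ss0 Ss1 s01 SAS.
    have good' : good (S', f') by split=> //= x /S0S /SS'.
    exfalso; apply: S'S.
    suff /asboolP[] : extends (exist good (S', f') good')
        (exist good (S, f) (And3 S0S SA pf)) by [].
    by apply: Smax; apply/asboolP; split=> //= x y Sx Sy; rewrite f'f.
  have [e [eS einj]] := pairing_double pf Ss0 Ss1 s01 ASS.
  have AU x : A x -> (S `|` A `\` S) x.
    by move=> Ax; have [Sx|nSx] := pselect (S x); [left|right].
  apply: (inj_on_card_le (f := e)) => [x /AU/eS//|x y /AU Ax /AU Ay].
  exact: einj.
apply: card_le_trans (card_le_setX AS AS) _.
exact: card_le_trans (pairing_card_le pf) (subset_card_le SA).
Qed.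

End square.

(** * Characters of compact lines *)

Lemma compact_line_normal d (K : compactLineType d) : normal_space K.
Proof.
by apply: compact_normal; [exact: order_hausdorff|exact: compact_space].
Qed.

Lemma separating_function (R : realType) d (K : compactLineType d)
    (A B : set K) :
  closed A -> closed B -> A `&` B = set0 ->
  exists f : continuous_fun R K,
    (forall x, A x -> f x = 0) /\ forall x, B x -> f x = 1.
Proof.
move=> cA cB AB.
have /(@uniform_separatorP K R)[f [fc _ fA fB]] :=
  normal_uniform_separator (@compact_line_normal d K) cA cB AB.
by exists (mkcf fc); split=> x xA; [apply: fA|apply: fB]; exists x.
Qed.

(** The half-lines below and above x are treated together: A is one of them, and
[le a b] says that b is at least as close to x as a. *)
Section one_side.
Context {R : realType} {d : Order.disp_t} {K : compactLineType d}.
Local Notation CK := (continuous_fun R K).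
Context {U : Type} (kappa : set U).
Hypothesis kappa_infinite : infinite_set kappa.

Definition eventual_limits_continuous :=
  forall (I : Type) (le : I -> I -> Prop),
  (forall i j k, le i j -> le j k -> le i k) -> bounded_families kappa le ->
  forall (f : I -> CK) (phi : K -> R),
  eventually_equal le (fun i => eval_cf (f i)) phi -> continuous phi.

Hypothesis limits_continuous : eventual_limits_continuous.

Variables (x : K) (A : set K) (le : K -> K -> Prop).
Hypothesis le_trans : forall a b c, le a b -> le b c -> le a c.
Hypothesis le_total : forall a b, le a b \/ le b a.
Hypothesis Aopen : open A.
Hypothesis xA : ~ A x.
Hypothesis le_closed : forall a, A a -> closed [set z | A z /\ le z a].
Hypothesis nbhs_side : forall N, nbhs x N ->
  (exists2 a, A a & forall z, A z -> ~ le z a -> N z) \/ A `<=` N.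

(** If no small subset of A is cofinal, then A is a directed index set for
functions that are 0 on A up to a and 1 off A. Their eventual limit is the
indicator function of the complement of A, whose continuity at x contradicts
that A accumulates at x. *)
Lemma cofinal_subset : ~ nbhs x (~` A) ->
  exists S, [/\ S `<=` A, S #<= kappa
    & forall z, A z -> exists2 s, S s & le z s].
Proof.
move=> nA; apply: contrapT => ncof.
pose I := {z | A z}; pose leI (i j : I) := le (sval i) (sval j).
have leI_bounded : bounded_families kappa leI.
  move=> S Sk; apply: contrapT => nbound; apply: ncof; exists (sval @` S).
  split=> [_ [i _ <-]||z Az]; first exact: svalP.
    exact: card_le_trans (card_image_le _ _) Sk.
  apply: contrapT => nz; apply: nbound; exists (exist _ z Az) => i Si.
  have [//|zi] := le_total (sval i) z.
  by case: nz; exists (sval i) => //; exists i.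
have /choice[f fP] (i : I) : exists f : CK,
    (forall z, A z /\ le z (sval i) -> f z = 0) /\ (forall z, ~ A z -> f z = 1).
  apply: separating_function (le_closed (svalP i)) (open_closedC Aopen) _.
  by apply/seteqP; split=> z // [[]].
pose phi z : R := if pselect (A z) then 0 else 1.
have fphi : eventually_equal leI (fun i => eval_cf (f i)) phi.
  move=> z; rewrite /phi; case: pselect => Az.
    by exists (exist _ z Az) => j zj; apply: (fP j).1.
  have [i _] := leI_bounded set0 (card_ge0 _ _).
  by exists i => j _; exact: (fP j).2.
have : continuous phi.
  apply: limits_continuous fphi => // i j k; exact: le_trans.
move=> /(_ x)/cvgrPdist_lt/(_ 1 ltr01) phix.
apply: nA; apply: filterS phix => z.
rewrite /phi; case: pselect => // nAx; case: pselect => // Az.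
by rewrite subr0 normr1 ltxx.
Qed.

Lemma one_sided_base : exists F : set (set K),
  [/\ F #<= kappa, F `<=` open_nbhs x
    & forall N, nbhs x N -> exists2 V, F V & V `&` A `<=` N].
Proof.
have [xA'|nxA'] := pselect (nbhs x (~` A)).
  exists [set (~` A)^°]; split.
  - apply: card_le_trans (_ : [set: nat] #<= _); last exact/infiniteP.
    by apply: finite_set_countable.
  - by move=> _ ->; split; [exact: open_interior|].
  - move=> N _; exists (~` A)^° => // z [/interior_subset].
    by [].
have [S [SA Sk Scof]] := cofinal_subset nxA'.
exists ((fun s => ~` [set z | A z /\ le z s]) @` S); split.
- exact: card_le_trans (card_image_le _ _) Sk.
- move=> _ [s Ss <-]; split; last by case.
  exact/closed_openC/le_closed/SA.
move=> N /nbhs_side[[a Aa aN]|AN].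
  have [s Ss a_s] := Scof a Aa.
  exists (~` [set z | A z /\ le z s]); first by exists s.
  move=> z [nz Az]; apply: aN => // za; apply: nz; split=> //.
  exact: le_trans a_s.
have [a Aa] : A !=set0.
  apply/set0P; apply/negP => /eqP A0; apply: nxA'; rewrite A0 setC0.
  exact: filterT.
have [s Ss a_s] := Scof a Aa.
exists (~` [set z | A z /\ le z s]); first by exists s.
by move=> z [_ /AN].
Qed.

End one_side.

Section small_base.
Context {R : realType} {d : Order.disp_t} {K : compactLineType d}.
Context {U : Type} (kappa : set U).
Hypothesis kappa_infinite : infinite_set kappa.
Hypothesis limits_continuous : @eventual_limits_continuous R d K U kappa.

Lemma left_base (x : K) : exists F : set (set K), [/\ F #<= kappa,
  F `<=` open_nbhs x & forall N, nbhs x N ->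
    exists2 V, F V & V `&` [set z | (z < x)%O] `<=` N].
Proof.
have lrayE (y : K) : [set z | (z < y)%O] = `]-oo, y[%classic.
  by apply/seteqP; split=> z; rewrite /= in_itv.
apply: (one_sided_base kappa_infinite limits_continuous
  (le := fun a b => (a <= b)%O)).
- by move=> a b c; exact: le_trans.
- by move=> a b; apply/orP; exact: le_total.
- by rewrite lrayE; exact: lray_open.
- by rewrite /= ltxx.
- move=> a /= ax.
  rewrite (_ : [set z | _] = `]-oo, a]%classic); first exact: lray_closed.
  apply/seteqP; split=> z; rewrite /= in_itv /=; first by case.
  by move=> za; split=> //; exact: le_lt_trans ax.
- move=> N /nbhs_box[[s|] [b [/andP[/= sx xb] boxN]]]; [left|right].
    exists s => // z zx /negP; rewrite -ltNge => sz.
    apply: boxN; rewrite /box /= sz /=.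
    by case: (b) xb => //= t; exact: lt_trans.
  move=> z zx; apply: boxN; rewrite /box /=.
  by case: (b) xb => //= t; exact: lt_trans.
Qed.

Lemma right_base (x : K) : exists F : set (set K), [/\ F #<= kappa,
  F `<=` open_nbhs x & forall N, nbhs x N ->
    exists2 V, F V & V `&` [set z | (x < z)%O] `<=` N].
Proof.
have rrayE (y : K) : [set z | (y < z)%O] = `]y, +oo[%classic.
  by apply/seteqP; split=> z; rewrite /= in_itv /= andbT.
apply: (one_sided_base kappa_infinite limits_continuous
  (le := fun a b => (b <= a)%O)).
- by move=> a b c ba cb; exact: le_trans cb ba.
- by move=> a b; apply/orP; exact: le_total.
- by rewrite rrayE; exact: rray_open.
- by rewrite /= ltxx.
- move=> a /= xa.
  rewrite (_ : [set z | _] = `[a, +oo[%classic); first exact: rray_closed.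
  apply/seteqP; split=> z; rewrite /= in_itv /= andbT; first by case.
  by move=> az; split=> //; exact: lt_le_trans az.
- move=> N /nbhs_box[a [[t|] [/andP[/= ax xt] boxN]]]; [left|right].
    exists t => // z xz /negP; rewrite -ltNge => zt.
    apply: boxN; rewrite /box /= zt andbT.
    by case: (a) ax => //= s sx; exact: lt_trans xz.
  move=> z xz; apply: boxN; rewrite /box /= andbT.
  by case: (a) ax => //= s sx; exact: lt_trans xz.
Qed.

Lemma min_local_base_le (x : K) : min_local_base x #<= kappa.
Proof.
have [F [Fk Fo FN]] := left_base x; have [G [Gk Go GN]] := right_base x.
apply: (@card_le_trans _ _ _ ((fun p => p.1 `&` p.2) @` (F `*` G))); last first.
  apply: card_le_trans (card_image_le _ _) _.
  exact: card_le_trans (card_le_setX Fk Gk) (card_le_square kappa_infinite).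
apply: (min_local_baseP x).2; split.
  move=> _ [[V W] [/= /Fo[oV xV] /Go[oW xW]] <-]; split=> //; exact: openI.
move=> N xN; have [V FV VN] := FN N xN; have [W GW WN] := GN N xN.
exists (V `&` W); first by exists (V, W).
move=> z [Vz Wz]; have [zx|xz|->] := ltgtP z x; [exact: VN|exact: WN|].
exact: nbhs_singleton xN.
Qed.

End small_base.

Section finite_case.
Context {d : Order.disp_t} {K : compactLineType d}.

Let closed_set1 (x : K) : closed [set x].
Proof. exact/accessible_closed_set1/hausdorff_accessible/order_hausdorff. Qed.

Lemma finite_base_isolated (x : K) :
  finite_set (min_local_base x) -> open [set x].
Proof.
have [[Bo Bbase] _] := min_local_baseP x; move=> Bfin.
rewrite (_ : [set x] = ~` \bigcup_(V in min_local_base x) ~` V).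
  apply/closed_openC/closed_bigcup => // V /Bo[Vo _]; exact: open_closedC.
apply/seteqP; split=> [_ ->|z nz]; first by move=> [V /Bo[_ xV]]; apply.
apply: contrapT => zx; apply: nz.
have [V BV Vz] : filter_from (min_local_base x) id (~` [set z]).
  apply: Bbase; apply: open_nbhs_nbhs; split; first exact/closed_openC.
  by move=> xz; apply: zx.
by exists V => // /Vz; apply.
Qed.

(** If the character is finite, then every point has a finite base, hence is
isolated, and compactness makes K finite. *)
Lemma infinite_character : infinite_set [set: K] -> infinite_set (character K).
Proof.
move=> Kinf cfin; apply: Kinf.
apply: compact_set_ind; first exact: compact_space.
- exact: finite_set0.
- by move=> B C BC; exact: sub_finite_set.
- by move=> B C ? ?; rewrite finite_setU.
move=> x _; exists [set x]; last exact: finite_set1.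
apply: open_nbhs_nbhs; split=> //; apply: finite_base_isolated.
exact: card_le_finite ((card_sup_spec _).1 x) cfin.
Qed.

Lemma min_local_base_le1 (T : Type) (B : set T) (x : K) : finite_set [set: K] ->
  B !=set0 -> min_local_base x #<= B.
Proof.
move=> Kfin [b Bb]; apply: (@card_le_trans _ _ _ [set [set x]]).
  apply: (min_local_baseP x).2; split=> [_ ->|N xN].
    split=> //; rewrite -[X in open X]setCK; apply: closed_openC.
    apply: accessible_finite_set_closed.1.
      exact/hausdorff_accessible/order_hausdorff.
    exact: sub_finite_set Kfin.
  by exists [set x] => // _ ->; exact: nbhs_singleton xN.
by apply: (inj_on_card_le (f := fun=> b)) => // V W -> ->.
Qed.

Lemma min_local_base_neq0 (x : K) : min_local_base x !=set0.
Proof.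
have [[_ Bbase] _] := min_local_baseP x.
by have [V BV _] := Bbase setT filterT; exists V.
Qed.

Lemma kronecker_functions (R : realType) (m : nat) (p : 'I_m -> K) :
  injective p ->
  exists f : 'I_m -> continuous_fun R K, forall i j, f i (p j) = (i == j)%:R.
Proof.
move=> pinj; suff /choice[f fP] i : exists f : continuous_fun R K,
    forall j, f (p j) = (i == j)%:R by exists f.
have [||f [f0 f1]] :=
  @separating_function R _ K (p @` [set~ i]) [set p i] _ (@closed_set1 (p i)).
- apply: accessible_finite_set_closed.1.
    exact/hausdorff_accessible/order_hausdorff.
  by apply: finite_image; exact: finite_finset.
- by apply/seteqP; split=> // z [[j ji <-]] /pinj.
exists f => j; have [<-|ij] := eqVneq i j; first exact: f1.
by apply: f0; exists j => // ji; rewrite ji eqxx in ij.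
Qed.

End finite_case.

Lemma sum_cfE (R : realType) (K : compactTopologicalType) (m : nat)
    (f : 'I_m -> continuous_fun R K) x :
  eval_cf (\sum_i f i) x = \sum_i eval_cf (f i) x.
Proof. by elim/big_rec2: _ => // i r g _ <-. Qed.

Section main.
Context {R : realType} {d1 d2 : Order.disp_t}.
Context {K : compactLineType d1} {L : compactLineType d2}.
Local Notation CK := (continuous_fun R K).
Local Notation CL := (continuous_fun R L).
Variables (T : {linear CK -> CL}) (S : {linear CL -> CK}).
Hypothesis TK : cancel T S.
Hypotheses (Tcont : continuous T) (Scont : continuous S).

(** Dimension count: the identity matrix of size m, obtained by evaluating
Kronecker functions at the points p i, factors through C(L), whose coordinates
are the n values at the points q j. *)
Lemma finite_points_le (m n : nat) (p : 'I_m -> K) (q : 'I_n -> L) :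
  injective p -> injective q -> (forall y, exists j, q j = y) -> (m <= n)%N.
Proof.
move=> pinj qinj qsurj.
have [f fp] := kronecker_functions R pinj.
have [g gq] := kronecker_functions R qinj.
pose A : 'M[R]_(m, n) := \matrix_(i, j) (S (g j) : CK) (p i).
pose B : 'M[R]_(n, m) := \matrix_(j, k) (T (f k) : CL) (q j).
apply: (@mulmx1_min _ _ _ A B); apply/matrixP => i k; rewrite !mxE.
have Tf : T (f k) = \sum_j eval_cf (T (f k)) (q j) *: g j.
  apply: cfP => y; have [j <-] := qsurj y; rewrite sum_cfE (bigD1 j) //.
  rewrite big1 => [|j' /negbTE j'j]; last by rewrite cfZE gq j'j mulr0.
  by rewrite cfZE gq eqxx mulr1 /= addr0.
have -> : (i == k)%:R = eval_cf (S (T (f k))) (p i) by rewrite TK fp eq_sym.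
rewrite Tf linear_sum sum_cfE; apply: eq_bigr => j _.
by rewrite !mxE linearZ cfZE mulrC.
Qed.

Lemma character_le : character K #<= character L.
Proof.
apply: (card_sup_spec _).2 => x.
have [Lfin|Linf] := pselect (finite_set [set: L]); last first.
  have kinf := infinite_character Linf.
  apply: (min_local_base_le kinf) => I le letr bnd f phi.
  apply: (eventual_limit_iso TK Tcont Scont kinf _ letr bnd).
  exact: (card_sup_spec _).1.
pose s := finmap.enum_fset (fset_set [set: L]).
pose q (j : 'I_(size s)) := tnth (in_tuple s) j.
have qinj : injective q by apply/tuple_uniqP; exact: finmap.fset_uniq.
have qsurj y : exists j, q j = y.
  have ys : y \in in_tuple s by rewrite /= in_fset_set // in_setT.
  by have /tnthP[j ->] := ys; exists j.
have injK (m : nat) (p : 'I_m -> K) : injective p -> (m <= size s)%N.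
  by move=> pinj; exact: finite_points_le pinj qinj qsurj.
have [y _] : exists y : L, True.
  have /(injK 1%N) : injective (fun _ : 'I_1 => x).
    by move=> i j _; rewrite !ord1.
  by move=> s0; exists (q (Ordinal s0)).
apply: (@card_le_trans _ _ _ (min_local_base y)); last first.
  exact: (card_sup_spec _).1.
apply: min_local_base_le1 (min_local_base_neq0 y).
apply: contrapT => /infiniteP/(card_le_inj_on x)[p [_ pinj]].
suff : ((size s).+1 <= size s)%N by rewrite ltnn.
apply: (injK _ (fun i => p i)) => i j /pinj ij.
by apply: val_inj; exact: ij.
Qed.

End main.

Theorem corollary4p6 (R : realType) (d1 d2 : Order.disp_t)
    (K : compactLineType d1) (L : compactLineType d2) :
  isomorphic (continuous_fun R K) (continuous_fun R L) ->
  character K #= character L.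
Proof.
move=> [T [S [TK ST Tcont Scont]]].
pose S' := HB.pack_for {linear continuous_fun R L -> continuous_fun R K} S
  (GRing.isLinear.Build R _ _ _ S (can2_linear TK ST)).
apply/card_eqPle; split.
  exact: (@character_le _ _ _ _ _ T S').
exact: (@character_le _ _ _ _ _ S' T).
Qed.
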